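(* For each integer $s\ge 1$, if $n\ge \operatorname{Ram}(4,7;s^2)$, then $\operatorname{ldim}(I_n)>s$.
   Context: For $n\ge 2$, the canonical interval order $I_n$ is the poset whose elements are the closed intervals $[i,j]$ with $i<j$ integers in $\{1,\dots,n\}$, ordered by $[i,j]<[k,l]$ iff $j<k$. $\operatorname{Ram}(k,h;r)$ denotes the least positive integer $N$ such that for every $n\ge N$ and every coloring of the $k$-element subsets of $\{1,\dots,n\}$ with $r$ colors there is an $h$-element subset all of whose $k$-element subsets receive the same color. A partial linear extension (ple) of a poset $P$ is a linear extension of a subposet of $P$. For a family $\mathcal{L}$ of ple's, $\mu(u,\mathcal{L})$ is the number of members containing $u$ and $\mu(\mathcal{L})=\max_u \mu(u,\mathcal{L})$. A non-empty family $\mathcal{L}$ of ple's is a local realizer of $P$ if (1) whenever $x\le y$ in $P$ some $L\in\mathcal{L}$ has $x\le y$ in $L$, and (2) whenever $x\parallel y$ in $P$ some $L\in\mathcal{L}$ has $x>y$ in $L$. $\operatorname{ldim}(P)$ is the minimum of $\mu(\mathcal{L})$ over local realizers $\mathcal{L}$ of $P$. *)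

(* Defs.v *)
From HB Require Import structures.
From mathcomp Require Import all_boot all_order.
From mathcomp Require Import boolp.

Set Implicit Arguments.
Unset Strict Implicit.
Unset Printing Implicit Defensive.

Import Order.TTheory.

(* The points {1, ..., n} are represented by ['I_n]; a coloring is defined on the
   [k]-element subsets only, so for [r = 0] there is one only when [n < k]. *)
Definition ramsey_arrow (k h r n : nat) : Prop :=
  forall c : {A : {set 'I_n} | #|A| == k} -> 'I_r,
  exists H : {set 'I_n}, #|H| = h /\
    forall A B : {A : {set 'I_n} | #|A| == k},
      val A \subset H -> val B \subset H -> c A = c B.

Definition ramsey_bound (k h r N : nat) : Prop :=
  0 < N /\ forall n, N <= n -> ramsey_arrow k h r n.

Lemma subset_of_card (T : finType) (S : {set T}) (h : nat) :
  h <= #|S| -> exists H : {set T}, H \subset S /\ #|H| = h.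
Proof.
case/card_geqP => s [us szs sS]; exists [set x in s]; split.
  by apply/subsetP => x; rewrite inE; apply: sS.
by rewrite cardsE -szs; apply/card_uniqP.
Qed.

(* [endhom k c w]: [w] lists distinct points, each paired with a color, and
   adding a point to any [k]-subset of its successors gives that color. *)
Fixpoint endhom (k : nat) (C : finType) (T : finType) (c : {set T} -> C)
    (w : seq (T * C)) : Prop :=
  if w is (x, a) :: w' then
    [/\ x \notin [set p.1 | p in w'],
        forall A : {set T}, A \subset [set p.1 | p in w'] -> #|A| = k ->
          c (x |: A) = a
      & endhom k c w']
  else True.

Lemma endhom_mono (k : nat) (C : finType) (T : finType) (c : {set T} -> C)
    (w : seq (T * C)) (a : C) : endhom k c w ->
  let X := [set p.1 | p in [seq p <- w | p.2 == a]] in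
  #|X| = count (fun p => p.2 == a) w /\
  forall A : {set T}, A \subset X -> #|A| = k.+1 -> c A = a.
Proof.
elim: w => [_|[x b] w IHw [xNw xw /IHw {IHw} [cardX monoX]]] /=.
  have -> : [set p.1 | p in ([::] : seq (T * C))] = set0.
    by apply/setP => y; rewrite inE; apply/imsetP => -[].
  by rewrite cards0; split=> // A; rewrite subset0 => /eqP->; rewrite cards0.
set X := [set p.1 | p in _] in cardX monoX *.
have XW : X \subset [set p.1 | p in w].
  apply/subsetP => y /imsetP[p]; rewrite mem_filter => /andP[_ pw] ->.
  exact: imset_f.
case: eqP => [ba|_] //=; subst b.
have -> : [set p.1 | p in (x, a) :: [seq p <- w | p.2 == a]] = x |: X.
  apply/setP => y; rewrite in_setU1; apply/imsetP/orP.
    move=> [p]; rewrite in_cons => /orP[/eqP-> ->|pw ->]; first by left.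
    by right; apply: imset_f.
  case=> [/eqP->|/imsetP[p pw ->]].
    by exists (x, a) => //; rewrite mem_head.
  by exists p => //; rewrite in_cons pw orbT.
have xNX : x \notin X by apply: contra xNw; apply: (subsetP XW).
split=> [|A AX cA]; first by rewrite cardsU1 xNX cardX.
have [xA|xNA] := boolP (x \in A); last first.
  apply: monoX => //; apply/subsetP => y yA.
  move: (subsetP AX _ yA); rewrite in_setU1 => /orP[/eqP yx|//].
  by rewrite -yx yA in xNA.
rewrite -(setD1K xA); apply: xw.
  by apply: subset_trans XW; rewrite subDset.
by move: cA; rewrite (cardsD1 x) xA => -[].
Qed.

Lemma sum_count_color (C : finType) (S : Type) (w : seq (S * C)) :
  \sum_(a : C) count (fun p => p.2 == a) w = size w.
Proof.
elim: w => [|[x b] w IHw] /=; first by rewrite big1.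
by rewrite big_split /= IHw (bigD1 b) //= eqxx big1 // => a /negbTE;
  rewrite eq_sym => ->.
Qed.

Lemma ramsey_finset (C : finType) (k h : nat) : exists N : nat,
  forall (T : finType) (S : {set T}) (c : {set T} -> C), N <= #|S| ->
  exists (H : {set T}) (a : C), [/\ H \subset S, #|H| = h &
    forall A : {set T}, A \subset H -> #|A| = k -> c A = a].
Proof.
elim: k h => [|k IHk] h.
  exists h => T S c /subset_of_card[H [HS cH]]; exists H, (c set0).
  by split=> // A _ /eqP; rewrite cards_eq0 => /eqP ->.
have [N HN] : exists N : nat,
    forall (T : finType) (S : {set T}) (c : {set T} -> C), N <= #|S| ->
    exists w : seq (T * C), [/\ size w = (#|C| * h).+1,
      [set p.1 | p in w] \subset S & endhom k c w].
  elim: (_.+1) => [|m [M HM]].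
    exists 0 => T S c _; exists [::]; split=> //.
    by apply/subsetP => y /imsetP[].
  have [N HN] := IHk M; exists N.+1 => T S c NS.
  have /card_gt0P[x xS] : 0 < #|S| by apply: leq_trans NS.
  have NSx : N <= #|S :\ x| by move: NS; rewrite (cardsD1 x) xS.
  have [H [a [HS cH Ha]]] := HN T (S :\ x) (fun A => c (x |: A)) NSx.
  have [w [sw wH ew]] := HM T H c (eq_leq (esym cH)).
  have wS := subset_trans wH HS.
  exists ((x, a) :: w); split=> /=; first by rewrite sw.
    apply/subsetP => y /imsetP[p]; rewrite in_cons => /orP[/eqP-> -> //|pw ->].
    have := subsetP wS p.1 (imset_f _ pw).
    by rewrite in_setD1 => /andP[].
  split=> //.
    by apply/negP => /(subsetP wS); rewrite in_setD1 eqxx.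
  by move=> A Aw; apply: Ha; apply: subset_trans wH.
exists N => T S c NS; have [w [sw wS ew]] := HN T S c NS.
have [a ha] : exists a : C, h <= count (fun p => p.2 == a) w.
  apply/existsP; apply: contraT => /existsPn small.
  suff: size w <= #|C| * h by rewrite sw ltnn.
  rewrite -sum_count_color -sum_nat_const leq_sum // => a _.
  by rewrite ltnW // ltnNge small.
have [cX mX] := endhom_mono a ew.
rewrite -cX in ha; have [H [HX cH]] := subset_of_card ha.
exists H, a; split=> // [|A AH]; last exact/mX/(subset_trans AH).
apply: (subset_trans HX); apply: subset_trans wS.
apply/subsetP => y /imsetP[p]; rewrite mem_filter => /andP[_ pw] ->.
exact: imset_f.
Qed.

Theorem ramsey (k h r : nat) : exists N, ramsey_bound k h r N.
Proof.
have [N HN] := ramsey_finset (option 'I_r) k h.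
exists N.+1; split=> // n Nn c.
pose c' (A : {set 'I_n}) := omap c (insub A).
have NT : N <= #|[set: 'I_n]| by rewrite cardsT card_ord ltnW.
have [H [a [_ cH Ha]]] := HN _ setT c' NT; exists H; split=> // A B AH BH.
have c'E (X : {A : {set 'I_n} | #|A| == k}) : c' (val X) = Some (c X).
  by rewrite /c' valK.
have := Ha _ AH (eqP (valP A)); rewrite -(Ha _ BH (eqP (valP B))) !c'E.
by case.
Qed.

Lemma ramsey_asbool (k h r : nat) : exists N, `[< ramsey_bound k h r N >].
Proof. by have [N HN] := ramsey k h r; exists N; apply/asboolP. Qed.

Definition Ram (k h r : nat) : nat := ex_minn (ramsey_asbool k h r).

Lemma RamP (k h r : nat) : ramsey_bound k h r (Ram k h r).
Proof. by rewrite /Ram; case: ex_minnP => N /asboolP. Qed.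

Lemma Ram_min (k h r N : nat) : ramsey_bound k h r N -> Ram k h r <= N.
Proof. by move=> HN; rewrite /Ram; case: ex_minnP => m _; apply; apply/asboolP. Qed.

Section LocalDimension.
Context {d : Order.disp_t} (P : finPOrderType d).
Local Open Scope order_scope.

(* The relation [ple_le] is false outside of the ground set [ple_dom]. *)
Record ple := Ple {
  ple_dom : {set P};
  ple_le : rel P;
  ple_supp : forall x y, ple_le x y -> (x \in ple_dom) && (y \in ple_dom);
  ple_refl : {in ple_dom, reflexive ple_le};
  ple_anti : antisymmetric ple_le;
  ple_trans : transitive ple_le;
  ple_total : {in ple_dom &, total ple_le};
  ple_ext : {in ple_dom &, forall x y, x <= y -> ple_le x y}
}.

Definition ple_lt (L : ple) (x y : P) : bool := (x != y) && ple_le L x y.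

(* A family is a finite list, so a ple may occur in it several times. *)
Definition mu_at (u : P) (F : seq ple) : nat :=
  count (fun L => u \in ple_dom L) F.

Definition mu (F : seq ple) : nat := (\max_(u : P) mu_at u F)%N.

Definition local_realizer (F : seq ple) : Prop :=
  [/\ F <> [::],
      forall x y : P, x <= y -> has (fun L => ple_le L x y) F
    & forall x y : P, x >< y -> has (fun L => ple_lt L y x) F].

Lemma ple_pair (x y : P) : ~~ (y < x) -> exists L : ple, ple_le L x y.
Proof.
move=> Nyx.
pose D := [set x; y].
pose le (a b : P) := [&& a \in D, b \in D & (a == x) || (b == y)].
have inD a : (a \in D) = (a == x) || (a == y) by rewrite !inE.
have DP a : a \in D -> a = x \/ a = y.
  by rewrite inD => /orP[/eqP|/eqP]; [left | right].
have xD : x \in D by rewrite inD eqxx.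
have yD : y \in D by rewrite inD eqxx orbT.
have supp a b : le a b -> (a \in D) && (b \in D) by case/and3P=> -> ->.
have refl : {in D, reflexive le} by move=> a aD; rewrite /le aD -inD.
have anti : antisymmetric le.
  move=> a b /andP[/and3P[aD bD /orP ab] /and3P[_ _ /orP ba]].
  case: (DP a aD) => ea; case: (DP b bD) => eb; move: ab ba; rewrite ?ea ?eb //.
    by move=> _ [/eqP|/eqP].
  by move=> [/eqP|/eqP].
have trans : transitive le.
  move=> b a c /and3P[aD bD /orP ab] /and3P[_ cD /orP bc].
  rewrite /le aD cD /=.
  case: ab => [-> //|/eqP eb]; case: bc => [/eqP ebx|->]; last by rewrite orbT.
  case: (DP c cD) => ec; last by rewrite ec eqxx orbT.
  by rewrite ec -{2}ebx eb eqxx orbT.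
have tot : {in D &, total le}.
  move=> a b aD bD; rewrite /le aD bD /=.
  by case: (DP a aD) => ->; rewrite eqxx ?orbT.
have ext : {in D &, forall a b, a <= b -> le a b}.
  move=> a b aD bD ab; rewrite /le aD bD /=.
  case: (DP a aD) => ea; first by rewrite ea eqxx.
  case: (DP b bD) => eb; last by rewrite eb eqxx orbT.
  move: ab; rewrite ea eb le_eqVlt (negbTE Nyx) orbF => /eqP ->.
  by rewrite eqxx.
by exists (Ple supp refl anti trans tot ext); rewrite /= /le xD yD eqxx.
Qed.

Lemma local_realizer_exists : exists F : seq ple, local_realizer F.
Proof.
have [L0] : exists L : ple, True.
  have supp0 (x y : P) : false -> (x \in set0) && (y \in set0) by [].
  have refl0 : {in set0, @reflexive P (fun _ _ => false)}.
    by move=> x; rewrite inE.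
  have anti0 : @antisymmetric P (fun _ _ => false) by [].
  have trans0 : @transitive P (fun _ _ => false) by [].
  have total0 : {in set0 &, @total P (fun _ _ => false)}.
    by move=> x y; rewrite inE.
  have ext0 : {in set0 &, forall x y : P, x <= y -> false}.
    by move=> x y; rewrite inE.
  by exists (Ple supp0 refl0 anti0 trans0 total0 ext0).
move=> _.
have /choice[f Hf] : forall p : P * P, exists L : ple,
    ~~ (p.2 < p.1) -> ple_le L p.1 p.2.
  move=> p.
  have [_|Nle] := boolP (p.2 < p.1); first by exists L0.
  by have [L HL] := ple_pair Nle; exists L.
have hasF p (a : pred ple) : a (f p) -> has a (L0 :: map f (enum {: P * P})).
  by move=> ap; rewrite /= has_map; apply/orP; right; apply/hasP;
    exists p; rewrite ?mem_enum.
exists (L0 :: map f (enum {: P * P})); split=> // x y xy.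
  by apply: (hasF (x, y)); apply: Hf; rewrite /= le_gtF.
apply: (hasF (y, x)); apply/andP; split.
  by apply: contraNneq xy => ->; rewrite comparablexx.
by apply: Hf; apply: contra xy => /lt_comparable.
Qed.

Lemma ldim_asbool :
  exists m, `[< exists F : seq ple, local_realizer F /\ mu F = m >].
Proof.
by have [F HF] := local_realizer_exists; exists (mu F); apply/asboolP; exists F.
Qed.

Definition ldim : nat := ex_minn ldim_asbool.

Lemma ldimP : exists F : seq ple, local_realizer F /\ mu F = ldim.
Proof. by rewrite /ldim; case: ex_minnP => m /asboolP. Qed.

Lemma ldim_min (F : seq ple) : local_realizer F -> (ldim <= mu F)%N.
Proof.
move=> HF; rewrite /ldim; case: ex_minnP => m _; apply.
by apply/asboolP; exists F.
Qed.

End LocalDimension.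

(* The endpoints range over ['I_n], i.e. over [{0, ..., n-1}] in place of
   [{1, ..., n}]. *)
Record interval_order (n : nat) := Interval {
  endpoints : 'I_n * 'I_n;
  endpoints_lt : endpoints.1 < endpoints.2
}.

HB.instance Definition _ n := [isSub for @endpoints n].
HB.instance Definition _ n := [Finite of interval_order n by <:].

Section IntervalOrder.
Variable n : nat.
Implicit Types u v : interval_order n.

Definition interval_lt u v : bool := (endpoints u).2 < (endpoints v).1.

Lemma interval_lt_irr : irreflexive interval_lt.
Proof. by move=> u; rewrite /interval_lt ltnNge ltnW // endpoints_lt. Qed.

Lemma interval_lt_trans : transitive interval_lt.
Proof.
move=> v u w uv vw; apply: ltn_trans uv _.
by apply: ltn_trans vw; apply: endpoints_lt.
Qed.

End IntervalOrder.

Fact interval_display : Order.disp_t. Proof. exact: Order.Disp tt tt. Qed.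

HB.instance Definition _ n := Order.Lt_isPOrder.Build interval_display
  (interval_order n) (@interval_lt_irr n) (@interval_lt_trans n).

Lemma lt_intervalE n (u v : interval_order n) :
  (u < v)%O = ((endpoints u).2 < (endpoints v).1).
Proof. by []. Qed.

Lemma le_intervalE n (u v : interval_order n) :
  (u <= v)%O = (u == v) || ((endpoints u).2 < (endpoints v).1).
Proof. by rewrite le_eqVlt. Qed.

(* Main.v *)
(* Suppose that every interval lies in at most s members of a local realizer.
   For a < b < c < d some member L reverses [a,c] || [b,d]; color {a,b,c,d} by
   the rank of L among the members containing [a,c] and its rank among those
   containing [b,d].  On a homogeneous set the first rank is constant, so L is a
   function of [a,c] alone, and likewise of [b,d] alone.  Hence the same L serves
   the crossing pairs of x0 < ... < x5, and in L we get
   [x3,x5] < [x2,x4] < [x1,x3] < [x0,x2], whereas [x0,x2] < [x3,x5] in the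
   interval order. *)
Require Import Defs.
From mathcomp Require Import all_boot all_order.
From mathcomp Require Import boolp.

Set Implicit Arguments.
Unset Strict Implicit.
Unset Printing Implicit Defensive.

Definition ord_sorted n : pred (seq 'I_n) := sorted (relpre val ltn).

Lemma ord_sorted_enum n (A : {set 'I_n}) : ord_sorted (enum A).
Proof.
rewrite /ord_sorted /enum_mem -enumT; apply: sorted_filter.
  by move=> ? ? ?; apply: ltn_trans.
by rewrite -sorted_map val_enum_ord iota_ltn_sorted.
Qed.

Lemma ord_sorted_uniq n (ys : seq 'I_n) : ord_sorted ys -> uniq ys.
Proof.
apply: sorted_uniq => [? ? ?|i]; [exact: ltn_trans | exact: ltnn].
Qed.

Lemma enum_ord_sorted n (ys : seq 'I_n) :
  ord_sorted ys -> enum [set y in ys] = ys.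
Proof.
move=> sys; apply: (@irr_sorted_eq _ (relpre val ltn)) => //.
- by move=> ? ? ?; apply: ltn_trans.
- by move=> i; apply: ltnn.
- exact: ord_sorted_enum.
- by move=> y; rewrite mem_enum inE.
Qed.

(** Each subset is coded by its increasing enumeration, so a coloring can tell its points apart by
    position; [enum_rank] turns colors in [C] into ordinals. *)
Lemma ramsey_arrow_sorted (k h n : nat) (C : finType) (g : seq 'I_n -> C) :
  ramsey_arrow k h #|C| n ->
  exists xs : seq 'I_n, [/\ size xs = h, ord_sorted xs &
    forall ys zs, ord_sorted ys -> ord_sorted zs -> size ys = k -> size zs = k ->
      {subset ys <= xs} -> {subset zs <= xs} -> g ys = g zs].
Proof.
move=> /(_ (fun A => enum_rank (g (enum (val A)))))[H [cH homH]].
exists (enum H); split; [by rewrite -cardE | exact: ord_sorted_enum |].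
move=> ys zs sys szs ky kz ysH zsH.
have card (ts : seq 'I_n) : ord_sorted ts -> size ts = k -> #|[set t in ts]| == k.
  by move=> /ord_sorted_uniq/card_uniqP <- <-; rewrite cardsE.
have sub (ts : seq 'I_n) : {subset ts <= enum H} -> [set t in ts] \subset H.
  by move=> tsH; apply/subsetP => t; rewrite inE => /tsH; rewrite mem_enum.
pose cell ts sts kts :=
  exist (fun A : {set 'I_n} => #|A| == k) [set t in ts] (card ts sts kts).
have := homH (cell _ sys ky) (cell _ szs kz) (sub _ ysH) (sub _ zsH).
by rewrite /= !enum_ord_sorted // => /enum_rank_inj.
Qed.

(** At the first element satisfying [a], the two ranks count the earlier elements kept by each
    filter. A ple containing two given intervals thus yields a pair of ranks, to be used as a
    color. *)
Lemma has_nth_filter2 (T : Type) (x0 : T) (p q a : pred T) (s : seq T) :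
    (forall x, a x -> p x && q x) -> has a s ->
  exists i j, [/\ i < count p s, j < count q s,
    nth x0 (filter p s) i = nth x0 (filter q s) j & a (nth x0 (filter p s) i)].
Proof.
move=> apq; elim: s => //= x s IHs; case ax: (a x) => /=.
  by move=> _; have /andP[-> ->] := apq x ax; exists 0, 0.
move=> /IHs[i [j [ip jq e ae]]].
by exists (p x + i), (q x + j); rewrite !ltn_add2l; case: (p x); case: (q x).
Qed.

Lemma mu_at_le_mu d (P : finPOrderType d) (u : P) (F : seq (ple P)) :
  mu_at u F <= mu F.
Proof. exact: leq_bigmax. Qed.

(** For [a,c] and [b,d] the list is a, b, c, d, so that crossing amounts to sortedness and the list
    can be colored directly. *)
Definition corners n (u v : interval_order n) : seq 'I_n :=
  [:: (endpoints u).1; (endpoints v).1; (endpoints u).2; (endpoints v).2].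

Lemma corners_inj n (u v u' v' : interval_order n) :
  corners u v = corners u' v' -> u = u' /\ v = v'.
Proof.
move=> -[u1 v1 u2 v2]; split; apply: val_inj.
  by rewrite /= (surjective_pairing (endpoints u)) u1 u2 -surjective_pairing.
by rewrite /= (surjective_pairing (endpoints v)) v1 v2 -surjective_pairing.
Qed.

Definition crossing n (u v : interval_order n) : bool := ord_sorted (corners u v).

Lemma crossing_incomparable n (u v : interval_order n) :
  crossing u v -> (u >< v)%O.
Proof.
case/and4P=> /= uv vu uv' _; rewrite /Order.comparable !le_intervalE.
have /negbTE-> : u != v by apply: contraTneq uv => ->; rewrite ltnn.
have /negbTE-> : v != u by apply: contraTneq uv => ->; rewrite ltnn.
rewrite negb_or /= -!leqNgt (ltnW vu) /=.
exact: ltnW (ltn_trans uv (ltn_trans vu uv')).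
Qed.

Lemma crossing_reversed n (F : seq (ple (interval_order n))) L0 u v :
    local_realizer F -> crossing u v ->
  exists i j, [/\ i < mu F, j < mu F,
    nth L0 [seq L <- F | u \in ple_dom L] i =
      nth L0 [seq L <- F | v \in ple_dom L] j
    & ple_lt (nth L0 [seq L <- F | u \in ple_dom L] i) v u].
Proof.
move=> [_ _ revF] /crossing_incomparable/revF hasF.
have domP L : ple_lt L v u -> (u \in ple_dom L) && (v \in ple_dom L).
  by case/andP=> _ /ple_supp/andP[-> ->].
have [i [j [iu jv e lt]]] := has_nth_filter2 L0 domP hasF.
by exists i, j; split=> //; [apply: leq_trans iu _ | apply: leq_trans jv _];
  apply: mu_at_le_mu.
Qed.

(** [f] reads the reversing ple off the left interval of a crossing pair, [g] off the right one;
    hence left intervals with a common right partner have the same [f]. *)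
Lemma shift_ple_contradiction n (x : nat -> 'I_n)
    (J : nat -> nat -> interval_order n)
    (f g : interval_order n -> ple (interval_order n)) :
    (forall i j, i < j -> j < 6 -> x i < x j) ->
    (forall i j, i < j -> j < 6 -> endpoints (J i j) = (x i, x j)) ->
    (forall i j k l, i < j -> j < k -> k < l -> l < 6 ->
       f (J i k) = g (J j l) /\ ple_lt (f (J i k)) (J j l) (J i k)) ->
  False.
Proof.
move=> xlt EJ fg.
have fgE i j k l ij jk kl l6 := (fg i j k l ij jk kl l6).1.
(* [J 1 3] and [J 0 3] share the right partner [J 2 4]; [J 0 3] and [J 0 2] share [J 1 4]. The next
   chain goes through [J 0 4] likewise. *)
have f13 : f (J 1 3) = f (J 0 2).
  by rewrite (fgE 1 2 3 4) // -(fgE 0 2 3 4) // (fgE 0 1 3 4) // -(fgE 0 1 2 4).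
have f24 : f (J 2 4) = f (J 0 2).
  by rewrite (fgE 2 3 4 5) // -(fgE 0 3 4 5) // (fgE 0 1 4 5) // -(fgE 0 1 2 5).
have [_ /andP[_ l10]] := fg 0 1 2 3 isT isT isT isT.
have [_ /andP[_]] := fg 1 2 3 4 isT isT isT isT; rewrite f13 => l21.
have [_ /andP[_]] := fg 2 3 4 5 isT isT isT isT; rewrite f24 => l32.
have l30 := ple_trans (ple_trans l32 l21) l10.
have /andP[D3 D0] := ple_supp l30.
have lt03 : (J 0 2 <= J 3 5)%O by rewrite le_intervalE !EJ // xlt ?orbT.
(* This ple extends the interval order, so it has both inequalities between the two intervals, whose
   left endpoints nevertheless differ. *)
have e : J 0 2 = J 3 5.
  by apply: (@ple_anti _ _ (f (J 0 2))); rewrite l30 ple_ext.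
by have := xlt 0 3 isT isT; move: (EJ 0 2 isT isT); rewrite e EJ // => -[-> _];
  rewrite ltnn.
Qed.

Theorem theorem2p1 (s n : nat) (hs : 1 <= s) (hn : Ram 4 7 (s ^ 2) <= n) :
  s < ldim (interval_order n).
Proof.
rewrite ltnNge; apply/negP => ldim_le_s.
have [F [realF muF]] := ldimP (interval_order n); rewrite -{}muF in ldim_le_s.
have [L0] : exists L : ple (interval_order n), True.
  by case: F {ldim_le_s} realF => [[]|L F _] //; exists L.
move=> _; pose members u := [seq L <- F | u \in ple_dom L].
pose reverses (u v : interval_order n) (p : 'I_s * 'I_s) :=
  nth L0 (members u) p.1 = nth L0 (members v) p.2 /\
  ple_lt (nth L0 (members u) p.1) v u.
(* Since [corners] is injective, a list constrains its color through at most one pair; lists without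
   a crossing pair get the color (0, 0), available as [s] is positive. *)
have /choice[g gP] : forall ys, exists p : 'I_s * 'I_s,
    forall u v, crossing u v -> corners u v = ys -> reverses u v p.
  move=> ys.
  have [[u [v [uv ysE]]]|none] :=
    pselect (exists u v, crossing u v /\ corners u v = ys); last first.
    exists (Ordinal hs, Ordinal hs) => u v uv uvE.
    by case: none; exists u, v.
  have [i [j [il jl e lt]]] := crossing_reversed L0 realF uv.
  exists (Ordinal (leq_trans il ldim_le_s), Ordinal (leq_trans jl ldim_le_s)).
  by move=> u' v' _; rewrite -ysE => /corners_inj[-> ->].
have arrow : ramsey_arrow 4 7 #|{: 'I_s * 'I_s}| n.
  by rewrite card_prod card_ord mulnn; apply: (RamP 4 7 (s ^ 2)).2.
have [xs [xs7 xs_sorted hom]] := ramsey_arrow_sorted g arrow.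
have [x0 _] : exists x : 'I_n, True by case: xs xs7 {xs_sorted hom} => // x; exists x.
pose x := nth x0 xs.
have xlt i j : i < j -> j < 7 -> x i < x j.
  move=> ij j7; apply: (@sorted_ltn_nth _ (relpre val ltn)) => //.
  - by move=> ? ? ?; apply: ltn_trans.
  - by rewrite inE xs7 (ltn_trans ij).
  - by rewrite inE xs7.
(* The default [x 0, x 1] only makes [J] total; it is never taken when i < j < 7. *)
pose J i j : interval_order n :=
  insubd (@Interval n (x 0, x 1) (xlt 0 1 isT isT)) (x i, x j).
have EJ i j : i < j -> j < 7 -> endpoints (J i j) = (x i, x j).
  by move=> ij j7; apply: insubdK; apply: (xlt i j).
have xmem i : i < 7 -> x i \in xs by move=> i7; rewrite mem_nth ?xs7.
(* By homogeneity any four points of [xs] give this same pair of ranks. *)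
pose p := g (map x [:: 0; 1; 2; 3]).
apply: (@shift_ple_contradiction n x J (fun u => nth L0 (members u) p.1)
  (fun u => nth L0 (members u) p.2)) => [i j ij j6|i j ij j6|i j k l ij jk kl l6].
- by apply: (xlt i j) => //; apply: ltnW.
- by apply: EJ => //; apply: ltnW.
have l7 : l < 7 := ltnW l6; have k7 := ltn_trans kl l7.
have j7 := ltn_trans jk k7; have i7 := ltn_trans ij j7.
have ik := ltn_trans ij jk; have jl := ltn_trans jk kl.
have ys_sorted : ord_sorted (map x [:: i; j; k; l]) by rewrite /ord_sorted /= !xlt.
have cornersE : corners (J i k) (J j l) = map x [:: i; j; k; l].
  by rewrite /corners !EJ.
have -> : p = g (map x [:: i; j; k; l]).
  apply: hom => //; first by rewrite /ord_sorted /= !xlt.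
    by apply/allP; rewrite /= !xmem.
  by apply/allP; rewrite /= !xmem.
by apply: gP => //; rewrite /crossing cornersE.
Qed.
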